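(* Let $(X,\mathcal{K})$ be a pair satisfying $(A0')$ and $(A1)$. Then for every function $f:X\rightarrow\overline{\mathcal{K}}$ we have $$f^{c(\varphi)c(\varphi)'}\leq f .$$ If $f:X\rightarrow\overline{\mathcal{K}}$ is topical, then $$f^{c(\varphi)c(\varphi)'}=f .$$ The converse of the latter implication is not true: the constant function $f\equiv\top$, which is anti-topical (and not topical), also satisfies $f^{c(\varphi)c(\varphi)'}=f$.
   Context: $(A0')$: $\mathcal{K}=(\mathcal{K},\oplus,\otimes)$ is a $b$-complete idempotent semifield, i.e. a semiring with idempotent addition, with zero $\varepsilon$ (neutral for $\oplus$, absorbing for $\otimes$) and unit $e$, in which every $\mu\neq\varepsilon$ is invertible for $\otimes$, ordered by $\lambda\leq\mu\Leftrightarrow\lambda\oplus\mu=\mu$, such that every subset bounded from above has a supremum (its sum) in $\mathcal{K}$ and $\otimes$ distributes over such suprema (such a $\mathcal{K}$ is commutative); and $X$ is a $b$-complete idempotent semimodule over $\mathcal{K}$: a semimodule with idempotent addition, ordered by $x\leq y\Leftrightarrow x\oplus y=y$, in which every subset bounded from above has a supremum (its sum), and the action $(\lambda,x)\mapsto\lambda x$ distributes over suprema of bounded-above sets of scalars and of vectors. Its zero is $\inf X$; thus $\varepsilon x=\inf X$ for $x\in X$ and $\lambda\inf X=\inf X$ for $\lambda\in\mathcal{K}$. $(A1)$: for all $x\in X$, $y\in X\setminus\{\inf X\}$ the set $\{\lambda\in\mathcal{K}:\lambda y\leq x\}$ is bounded from above in $\mathcal{K}$. It is assumed throughout that $\mathcal{K}$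 has no greatest element. Minimal enlargement: $\overline{\mathcal{K}}=\mathcal{K}\cup\{\top\}$, with $\top\notin\mathcal{K}$, $\alpha\leq\top$ and $\alpha\oplus\top=\top$ for all $\alpha\in\overline{\mathcal{K}}$. The product $\otimes$ (also written by concatenation) is extended by $\alpha\otimes\top=\top\otimes\alpha=\top$ for $\alpha\in\overline{\mathcal{K}}\setminus\{\varepsilon\}$ and $\alpha\otimes\varepsilon=\varepsilon\otimes\alpha=\varepsilon$ for $\alpha\in\overline{\mathcal{K}}$. A second product $\dot{\otimes}$ is defined by $\alpha\dot{\otimes}\beta=\alpha\otimes\beta$ for $\alpha,\beta\in\mathcal{K}$, and $\alpha\dot{\otimes}\top=\top\dot{\otimes}\alpha=\top$ for $\alpha\in\overline{\mathcal{K}}$. Conventions: $\varepsilon^{-1}=\top$, $\top^{-1}=\varepsilon$. Suprema and infima of values are taken in $\overline{\mathcal{K}}$. Extended residuation: $x/y:=\sup\{\lambda\in\mathcal{K}:\lambda y\leq x\}\in\overline{\mathcal{K}}$ for all $x,y\in X$ (so $x/\inf X=\top$). A function $f:X\to\overline{\mathcal{K}}$ is topical if it is increasing ($x'\leq x''\Rightarrow f(x')\leq f(x'')$) and homogeneous ($f(\lambda x)=\lambda\otimes f(x)$ for all $x\in X,\lambda\in\mathcal{K}$); it is anti-topical if it is decreasing ($x'\leq x''\Rightarrow f(x')\geq f(x'')$) and anti-homogeneous ($f(\lambda x)=\lambda^{-1}\dot{\otimes}f(x)$ for all $x\in X,\lambda\in\mathcal{K}$). $\varphi(x,y)=x/y$,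 and the $\varphi$-conjugate of $f:X\to\overline{\mathcal{K}}$ is $f^{c(\varphi)}(y):=\sup_{x\in X}f(x)^{-1}\otimes(x/y)$, $y\in X$. The dual of a mapping $u:\overline{\mathcal{K}}^{X}\to\overline{\mathcal{K}}^{Y}$ ($g\mapsto g^{u}$) is the mapping $u':\overline{\mathcal{K}}^{Y}\to\overline{\mathcal{K}}^{X}$ given by the pointwise infimum $h^{u'}:=\inf\{g\in\overline{\mathcal{K}}^{X}: g^{u}\leq h\}$. Here $Y=X$, $u=c(\varphi)$ is the mapping $f\mapsto f^{c(\varphi)}$, and $f^{c(\varphi)c(\varphi)'}:=(f^{c(\varphi)})^{c(\varphi)'}$. Inequalities between functions are pointwise. *)

(* Defs.v *)
From HB Require Import structures.
(* With all_algebra imported here, HB would ask for a join of [BIdem] below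
   with the ordered Z-modules. *)
From mathcomp Require Export all_boot all_order ssralg.
From mathcomp Require Export boolp classical_sets.

Set Implicit Arguments.
Unset Strict Implicit.
Unset Printing Implicit Defensive.

Import Order.TTheory GRing.Theory.
Local Open Scope classical_set_scope.
Local Open Scope ring_scope.
Local Open Scope order_scope.

Fact idem_display : Order.disp_t. Proof. exact: (Order.Disp tt tt). Qed.

(* The supremum of the empty set is 0, so the smallest element of V is 0. *)
HB.mixin Record isBCompleteIdem V
    of GRing.Nmodule V & Order.POrder idem_display V := {
  addrr_idem : forall x : V, x + x = x;
  ler_addE : forall x y : V, (x <= y) <-> (x + y = y);
  bcomplete : forall A : set V, has_ubound A -> exists s, supremums A s
}.

#[short(type="bIdemType")]
HB.structure Definition BIdem :=
  {V of GRing.Nmodule V & Order.POrder idem_display V & isBCompleteIdem V}.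

(* Commutativity of the product is a consequence, hence not an axiom.
   [sinv 0] is unconstrained, and is never used. *)
HB.mixin Record isBIdemSemifield K of BIdem K & GRing.PzSemiRing K := {
  sinv : K -> K;
  smulVr : forall m : K, m != 0 -> sinv m * m = 1;
  smulrV : forall m : K, m != 0 -> m * sinv m = 1;
  smul_supr : forall (l : K) (A : set K) (s : K),
    supremums A s -> supremums [set l * a | a in A] (l * s);
  smul_supl : forall (l : K) (A : set K) (s : K),
    supremums A s -> supremums [set a * l | a in A] (s * l)
}.

#[short(type="bIdemSemifieldType")]
HB.structure Definition BIdemSemifield :=
  {K of BIdem K & GRing.PzSemiRing K & isBIdemSemifield K}.

HB.mixin Record isBIdemSemimodule (K : bIdemSemifieldType) X
    of BIdem X & GRing.LSemiModule K X := {
  sscale_supl : forall (A : set K) (s : K) (x : X),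
    supremums A s -> supremums [set a *: x | a in A] (s *: x);
  sscale_supr : forall (l : K) (B : set X) (t : X),
    supremums B t -> supremums [set l *: b | b in B] (l *: t)
}.

#[short(type="bIdemSemimodType")]
HB.structure Definition BIdemSemimodule (K : bIdemSemifieldType) :=
  {X of BIdem X & GRing.LSemiModule K X & isBIdemSemimodule K X}.

(* inf X is the zero of X. *)
Definition A1 (K : bIdemSemifieldType) (X : bIdemSemimodType K) : Prop :=
  forall x y : X, y != 0 -> has_ubound [set l : K | l *: y <= x].

Definition no_greatest (K : bIdemSemifieldType) : Prop :=
  ~ exists m : K, forall l : K, l <= m.

(* The minimal enlargement of K: [Some a] is a in K, and [None] is the added
   greatest element. *)
Definition enlarge (K : Type) : Type := option K.

Definition topK {K : Type} : enlarge K := None.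
Definition inK {K : Type} (a : K) : enlarge K := Some a.

Section Enlarge.
Variable K : bIdemSemifieldType.
Implicit Types a b c : enlarge K.

HB.instance Definition _ := Choice.on (enlarge K).

Definition ele a b : bool :=
  match a, b with
  | Some x, Some y => x <= y
  | _, None => true
  | None, Some _ => false
  end.

Fact ele_refl : reflexive ele.
Proof. by case=> [x|] /=. Qed.

Fact ele_anti : antisymmetric ele.
Proof. by case=> [x|] [y|] //= /le_anti ->. Qed.

Fact ele_trans : transitive ele.
Proof. by case=> [y|] [x|] [z|] //=; apply: le_trans. Qed.

HB.instance Definition _ := Order.Le_isPOrder.Build idem_display (enlarge K)
  ele_refl ele_anti ele_trans.

(* The default value is only used for the empty set; every subset of
   [enlarge K] has a supremum and an infimum (see below). *)
Definition esup (A : set (enlarge K)) : enlarge K := supremum (inK 0) A.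
Definition einf (A : set (enlarge K)) : enlarge K := infimum topK A.

Definition emul a b : enlarge K :=
  match a, b with
  | Some x, Some y => inK (x * y)
  | _, _ => if (a == inK 0) || (b == inK 0) then inK 0 else topK
  end.

Definition edmul a b : enlarge K :=
  match a, b with
  | Some x, Some y => inK (x * y)
  | _, _ => topK
  end.

Definition einv a : enlarge K :=
  match a with
  | Some x => if x == 0 then topK else inK (sinv x)
  | None => inK 0
  end.

Lemma inK_ge0 a : inK 0 <= a.
Proof. by case: a => [x|] //; apply/ler_addE; rewrite add0r. Qed.

Lemma le_topK a : a <= topK.
Proof. by case: a. Qed.

Lemma esupP (A : set (enlarge K)) : supremums A (esup A).
Proof.
rewrite /esup /supremum; case: ifPn => [/eqP ->|_].
  by split=> [x []|x _]; apply: inK_ge0.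
suff [s sA] : exists s, supremums A s by apply: (xgetI _ sA).
have [[m mA]|noub] := pselect (exists m : K, ubound A (inK m)); last first.
  exists topK; split=> [x _|[m|] // mA]; first exact: le_topK.
  by case: noub; exists m.
have [|s [sub slub]] := @bcomplete K [set l | A (inK l)].
  by exists m => l /mA.
exists (inK s); split=> [[l|] Al|[l|] lA].
- exact: sub.
- exact: (mA _ Al).
- by apply: slub => k /lA.
- exact: le_topK.
Qed.

Lemma einfP (A : set (enlarge K)) : infimums A (einf A).
Proof.
rewrite /einf /infimum; case: ifPn => [/eqP ->|_].
  by split=> [x []|x _]; apply: le_topK.
suff sA : infimums A (esup (lbound A)) by apply: (xgetI _ sA).
have [ub lub] := esupP (lbound A); split=> // x Ax.
by apply: lub => y; apply.
Qed.

End Enlarge.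

Section Functions.
Variables (K : bIdemSemifieldType) (X : bIdemSemimodType K).
Implicit Type f : X -> enlarge K.

Definition residual (x y : X) : enlarge K :=
  esup [set inK l | l in [set l : K | l *: y <= x]].

Definition topical f : Prop :=
  {homo f : x y / x <= y} /\
  forall (x : X) (l : K), f (l *: x) = emul (inK l) (f x).

Definition antitopical f : Prop :=
  (forall x y : X, x <= y -> f y <= f x) /\
  forall (x : X) (l : K), f (l *: x) = edmul (einv (inK l)) (f x).

End Functions.

Definition conjugate (K : bIdemSemifieldType) (X Y : Type)
    (phi : X -> Y -> enlarge K) (f : X -> enlarge K) : Y -> enlarge K :=
  fun y => esup [set emul (einv (f x)) (phi x y) | x in [set: X]].

Definition dual (K : bIdemSemifieldType) (X Y : Type)
    (u : (X -> enlarge K) -> (Y -> enlarge K)) (h : Y -> enlarge K) :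
    X -> enlarge K :=
  fun x => einf [set g x | g in [set g | forall y, u g y <= h y]].

Definition biconjugate (K : bIdemSemifieldType) (X : bIdemSemimodType K)
    (f : X -> enlarge K) : X -> enlarge K :=
  dual (conjugate (@residual K X)) (conjugate (@residual K X) f).

(* Main.v *)
(** If [f] is topical then [l *: y <= x] gives [l * f y <= f x], so the
    conjugate of [f] at [y] is at most the inverse of [f y]. Any [f] with this
    property, the constant [topK] included, is its own biconjugate: since
    [1 <= y / y], a conjugate of [g] below that of [f] yields
    [(g y)^-1 <= (g y)^-1 * (y / y) <= (f y)^-1], that is [f y <= g y]. *)

Require Import Defs.

Set Implicit Arguments.
Unset Strict Implicit.
Unset Printing Implicit Defensive.

Import Order.TTheory GRing.Theory.
Local Open Scope classical_set_scope.
Local Open Scope ring_scope.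
Local Open Scope order_scope.

Section Semifield.
Variable K : bIdemSemifieldType.
Implicit Types (k l m n : K) (a b c : enlarge K).

Lemma smul_le2l k l m : l <= m -> k * l <= k * m.
Proof. by move=> /ler_addE lm; apply/ler_addE; rewrite -mulrDr lm. Qed.

Lemma smul_le2r k l m : l <= m -> l * k <= m * k.
Proof. by move=> /ler_addE lm; apply/ler_addE; rewrite -mulrDl lm. Qed.

Lemma sge0 l : 0 <= l.
Proof. by apply/ler_addE; rewrite add0r. Qed.

Lemma sle0 l : (l <= 0) = (l == 0).
Proof. by apply/idP/eqP => [l0|-> //]; apply/le_anti; rewrite l0 sge0. Qed.

(** If [1 = 0], every [l = 1 * l] is [0], and [0] would be a greatest element. *)
Lemma no_greatest_oner_neq0 : no_greatest K -> (1 : K) != 0.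
Proof.
move=> noK; apply/eqP => K10; apply: noK; exists 0 => l.
by rewrite -[l]mul1r K10 mul0r.
Qed.

Lemma sinv_neq0 m : (1 : K) != 0 -> m != 0 -> sinv m != 0.
Proof.
move=> K10 m0; apply: contra_neq K10 => im0.
by rewrite -(smulrV _ m0) im0 mulr0.
Qed.

Lemma einv0 : einv (inK (0 : K)) = topK.
Proof. by rewrite /einv /= eqxx. Qed.

Lemma emul0r a : emul (inK 0) a = inK 0.
Proof. by case: a => [x|] /=; rewrite ?mul0r// eqxx. Qed.

Lemma emulr0 a : emul a (inK 0) = inK 0.
Proof. by case: a => [x|] /=; rewrite ?mulr0// eqxx. Qed.

(** Between nonzero elements of [K], multiply by [n] on the left and by [m] on the right. As
    [1 != 0], inverses of nonzero elements are nonzero, so only [topK] is inverted to [0]. *)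
Lemma einv_le (K10 : (1 : K) != 0) a b : einv a <= einv b -> b <= a.
Proof.
case: a => [m|] ab; last exact: le_topK.
have [n0|] := eqVneq b (inK 0); first by rewrite n0; exact: inK_ge0.
case: b ab => [n|] /=; last first.
  case: (eqVneq m 0) => // m0 ab _; have im0 := sinv_neq0 K10 m0.
  by move: ab; rewrite [_ <= _]sle0 (negPf im0).
move=> + n0; have {}n0 : n != 0 by apply: contra_neq n0 => ->.
rewrite (negPf n0); case: (eqVneq m 0) => // m0 mn.
have {mn} : sinv m <= sinv n by [].
move=> /(smul_le2l n) /(smul_le2r m).
by rewrite -mulrA smulVr // mulr1 smulrV // mul1r.
Qed.

(** The delicate case is [a = topK], where [b = 0] would make the product [0]; but [1 <= 0]
    contradicts [K10]. *)
Lemma emul_ge1 (K10 : (1 : K) != 0) a b : inK 1 <= b -> a <= emul a b.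
Proof.
case: a b => [x|] [y|] //= y1.
- have : x * 1 <= x * y by apply: smul_le2l.
  by rewrite mulr1.
- by rewrite orbF; case: eqP => [[->]|].
- case: eqP => [[y0]|//]; move: y1; rewrite y0.
  by rewrite [_ <= _]sle0 (negPf K10).
Qed.

Lemma emul_le2l a b c : b <= c -> emul a b <= emul a c.
Proof.
case: a b c => [x|] [y|] [z|] //= yz.
- exact: (smul_le2l x yz).
- rewrite orbF; case: eqP => [[->]|_]; last exact: le_topK.
  by rewrite mul0r; exact: inK_ge0.
(* Multiplication by [topK] takes only the values [0] and [topK], and it gives [0] at [z] only if
   [z = 0], which forces [y = 0]. *)
- case: (eqVneq (inK y) (inK 0)) => [_|y0]; first exact: inK_ge0.
  case: eqP => [[z0]|_ //].
  have : y <= z by [].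
  by rewrite z0 sle0 => /eqP y0'; rewrite y0' eqxx in y0.
- by rewrite [X in _ <= X]/=; case: ifP => _; exact: le_topK.
Qed.

(** For finite [b], multiply by its inverse on the right; for [b = topK] the hypothesis forces
    [l = 0]. The value [b = 0] must be excluded: with [m = 0] it would put no constraint on [l]. *)
Lemma le_emul_einv l m b : b != inK 0 ->
  emul (inK l) b <= inK m -> inK l <= emul (inK m) (einv b).
Proof.
case: b => [n|] /= n0; last first.
  by rewrite orbF mulr0; case: eqP => [[->]|].
have {}n0 : n != 0 by apply: contra_neq n0 => ->.
rewrite (negPf n0) => lnm; have {lnm} : l * n <= m by [].
move=> /(smul_le2r (sinv n)).
by rewrite -mulrA smulrV // mulr1.
Qed.

(** Cancellation is only an inequality because of [m = 0], where the left side collapses to [0]. *)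
Lemma emul_einv_le m b : emul (einv (inK m)) (emul (inK m) b) <= b.
Proof.
have [->|m0] := eqVneq m 0; first by rewrite emul0r emulr0; exact: inK_ge0.
case: b => [n|]; last exact: le_topK.
by rewrite /= (negPf m0) /= mulrA smulVr // mul1r.
Qed.

End Semifield.

Section Biconjugate.
Variables (K : bIdemSemifieldType) (X : bIdemSemimodType K).
Implicit Types (f : X -> enlarge K) (x y : X).

Local Notation conj := (conjugate (@residual K X)).

Lemma residual_le x y (a : enlarge K) :
  (forall l : K, l *: y <= x -> inK l <= a) -> residual x y <= a.
Proof.
move=> la; have [_ lub] := esupP [set inK l | l in [set l : K | l *: y <= x]].
by apply: lub => _ [l lyx <-]; apply: la.
Qed.

Lemma residual_diag_ge1 x : inK 1 <= residual x x.
Proof.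
have [ub _] := esupP [set inK l | l in [set l : K | l *: x <= x]].
by apply: ub; exists 1 => //=; rewrite scale1r.
Qed.

Lemma biconjugate_le f x : biconjugate f x <= f x.
Proof.
have [lb _] := einfP [set g x | g in [set g | forall y, conj g y <= conj f y]].
(* [f] itself is one of the functions over which the infimum is taken. *)
by apply: lb; exists f => /=.
Qed.

Lemma biconjugate_id (K10 : (1 : K) != 0) f :
  (forall y, conj f y <= einv (f y)) -> biconjugate f = f.
Proof.
move=> cf; apply/funext => x; apply/le_anti; rewrite biconjugate_le /=.
have [_ glb] := einfP [set g x | g in [set g | forall y, conj g y <= conj f y]].
apply: glb => _ [g /= gf <-]; apply: (einv_le K10).
apply: le_trans (cf x); apply: le_trans (gf x).
apply: le_trans (emul_ge1 K10 _ (residual_diag_ge1 x)) _.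
(* What remains is that [conj g x] dominates its own term at [z = x]. *)
have [ub _] := esupP [set emul (einv (g z)) (residual z x) | z in [set: X]].
by apply: ub; exists x.
Qed.

Lemma topical_conjugate_le f y : topical f -> conj f y <= einv (f y).
Proof.
move=> [f_homo f_hom].
have [_ lub] :=
  esupP [set emul (einv (f z)) (residual z y) | z in [set: X]].
apply: lub => _ [x _ <-].
have [fy0|fy0] := eqVneq (f y) (inK 0); first by rewrite fy0 einv0 le_topK.
(* If [f x = topK], its inverse [0] annihilates the term. *)
case fx: (f x) => [m|]; last by rewrite emul0r; exact: inK_ge0.
(* Insert [m^-1 * (m * (f y)^-1)] as the middle term; it then suffices to bound [residual x y] by
   [m * (f y)^-1], one scalar [l] at a time. *)
apply: le_trans (emul_einv_le m _); apply: emul_le2l.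
apply: residual_le => l /f_homo; rewrite f_hom fx.
exact: le_emul_einv.
Qed.

(** Every term of the supremum carries the factor [einv topK = 0]. *)
Lemma topK_conjugate_le y : conj (fun=> topK) y <= einv topK.
Proof.
have [_ lub] := esupP [set emul (einv topK) (residual z y) | z in [set: X]].
by apply: lub => _ [x _ <-]; rewrite emul0r.
Qed.

Lemma topK_antitopical : antitopical (fun _ : X => topK : enlarge K).
Proof. by split=> [x y _|x l] //; rewrite /edmul; case: einv. Qed.

(** Homogeneity fails at the scalar [0], since [0] times [topK] is [0]. *)
Lemma topK_not_topical : ~ topical (fun _ : X => topK : enlarge K).
Proof. by move=> [_ /(_ 0 0)]; rewrite emul0r. Qed.

End Biconjugate.

Theorem theorem43 (K : bIdemSemifieldType) (X : bIdemSemimodType K)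
    (noK : no_greatest K) (hA1 : A1 X) :
  (forall (f : X -> enlarge K) (x : X), biconjugate f x <= f x) /\
  (forall f : X -> enlarge K, topical f -> biconjugate f = f) /\
  (~ (forall f : X -> enlarge K, biconjugate f = f -> topical f) /\
   antitopical (fun _ : X => topK : enlarge K) /\
   ~ topical (fun _ : X => topK : enlarge K) /\
   biconjugate (fun _ : X => topK : enlarge K) =
     (fun _ : X => topK : enlarge K)).
Proof.
have K10 := no_greatest_oner_neq0 noK.
have topK_id := biconjugate_id K10 (@topK_conjugate_le K X).
split; first exact: biconjugate_le.
split.
  by move=> f f_top; apply: biconjugate_id => // y; apply: topical_conjugate_le.
split; first by move=> /(_ _ topK_id) /topK_not_topical.
split; first exact: topK_antitopical.
by split; first exact: topK_not_topical.
Qed.
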